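(* For every $J_{\mathrm{ave}}\in[0,J_{\max}]$, the constrained two-player zero-sum game with payoff matrix $Z$, transmitter strategy set $\mathbf{X}$ and jammer strategy set $\mathbf{Y}_{\mathrm{LE}|J_{\mathrm{ave}}}$ has at least one Nash equilibrium $(\boldsymbol{x},\boldsymbol{y})$ with $\boldsymbol{x}\in\mathbf{X}$ and $\boldsymbol{y}\in\mathbf{Y}_{\mathrm{LE}|J_{\mathrm{ave}}}$.
   Context: Let $N_T\ge 1$ be an integer. Jamming power levels: real numbers $0=J_0<J_1<\dots<J_{N_T}=J_{\max}$, collected in the column vector $\boldsymbol{J}=(J_0,\dots,J_{N_T})^T$. Payoffs: real numbers $Z_0>Z_1>\dots>Z_{N_T}>0$. The payoff matrix $Z$ is the $(N_T+1)\times(N_T+1)$ lower triangular matrix, indexed by $0\le i,j\le N_T$, with $(i,j)$ entry equal to $Z_i$ if $j\le i$ and $0$ if $j>i$ (the transmitter, using a strategy that withstands jamming power up to $J_i$, receives $Z_i$ if the actual jamming power $J_j$ satisfies $J_j\le J_i$, and $0$ otherwise). The row player (transmitter) maximizes and the column player (jammer) minimizes. $\mathbf{X}=\mathbf{Y}$ is the set of probability vectors in $\mathbb{R}^{N_T+1}$ (entries indexed by $0,\dots,N_T$). For $0\le J_{\mathrm{ave}}\le J_{\max}$, $\mathbf{Y}_{\mathrm{LE}|J_{\mathrm{ave}}}=\{\boldsymbol{y}\in\mathbf{Y}: \boldsymbol{y}^T\boldsymbol{J}\le J_{\mathrm{ave}}\}$. The expected payoff is $Z(\boldsymbol{x},\boldsymbol{y})=\boldsymbol{x}^TZ\boldsymbol{y}$.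 A Nash equilibrium is a pair $(\boldsymbol{x}^*,\boldsymbol{y}^* )\in\mathbf{X}\times\mathbf{Y}_{\mathrm{LE}|J_{\mathrm{ave}}}$ such that $Z(\boldsymbol{x},\boldsymbol{y}^* )\le Z(\boldsymbol{x}^*,\boldsymbol{y}^* )\le Z(\boldsymbol{x}^*,\boldsymbol{y})$ for all $\boldsymbol{x}\in\mathbf{X}$ and $\boldsymbol{y}\in\mathbf{Y}_{\mathrm{LE}|J_{\mathrm{ave}}}$. *)

(* Defs.v *)
From HB Require Import structures.
From mathcomp Require Import all_boot all_order all_algebra.
From mathcomp Require Import classical_sets reals.

Set Implicit Arguments.
Unset Strict Implicit.
Unset Printing Implicit Defensive.

Import Order.TTheory GRing.Theory Num.Theory.

Local Open Scope classical_set_scope.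
Local Open Scope ring_scope.

Section ConstrainedGames.
Variable R : realType.

Definition prob_vectors (n : nat) : set 'cV[R]_n :=
  [set x | (forall i, 0 <= x i 0) /\ \sum_i x i 0 = 1].

Definition power_limited (n : nat) (J : 'cV[R]_n) (Jave : R) : set 'cV[R]_n :=
  [set y | prob_vectors y /\ (y^T *m J) 0 0 <= Jave].

Definition expected_payoff (m n : nat) (A : 'M[R]_(m, n))
    (x : 'cV[R]_m) (y : 'cV[R]_n) : R :=
  (x^T *m A *m y) 0 0.

(* The row player maximizes over X, the column player minimizes over Y. *)
Definition nash_equilibrium (m n : nat) (A : 'M[R]_(m, n))
    (X : set 'cV[R]_m) (Y : set 'cV[R]_n)
    (xs : 'cV[R]_m) (ys : 'cV[R]_n) : Prop :=
  [/\ X xs, Y ys,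
      forall x, X x -> expected_payoff A x ys <= expected_payoff A xs ys
    & forall y, Y y -> expected_payoff A xs ys <= expected_payoff A xs y].

Definition jamming_matrix (n : nat) (z : 'I_n -> R) : 'M[R]_n :=
  \matrix_(i, j) (if (j <= i)%N then z i else 0).

End ConstrainedGames.

Arguments prob_vectors {R} n _.

(* Main.v *)
(** Against the cumulative distribution [Y] of the jammer, row [i] pays [z i * Y i].
    Hence the cheapest jamming strategy capping the payoff at [v] has
    [Y i = min 1 (v / z i)]; if [z k <= v <= z i] for all [i < k], its mean power is
    [J k - v * D k], where [D k = \sum_(i < k) (J i.+1 - J i) / z i].
    The quantity [J k - z k * D k], the power needed to cap the payoff at [z k],
    is [0] for [k = 0].  If the budget suffices for the last index, the payoff is
    capped at [z ord_max], which the most robust row always earns.  Otherwise take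
    the first [k] for which the budget is too small and let
    [v = (J k - Jave) / D k], so that the budget is exactly spent.  Mixing the rows
    [i < k] proportionally to [(J i.+1 - J i) / z i] makes the payoff of column [j]
    equal to [maxr 0 (J k - J j) / D k], which is at least an affine function of the
    power [J j], and the power constraint then guarantees [v]. *)
Require Import Defs.
From HB Require Import structures.
From mathcomp Require Import all_boot all_order all_algebra.
From mathcomp Require Import classical_sets reals.
From mathcomp Require Import ring lra.

Set Implicit Arguments.
Unset Strict Implicit.
Unset Printing Implicit Defensive.

Import Order.TTheory GRing.Theory Num.Theory.

Local Open Scope ring_scope.

(** Applied to [xs] and [ys] themselves, the two bounds force their payoff to be [v], so it never
    has to be computed. *)
Lemma saddle_value_nash (R : realType) (m n : nat) (A : 'M[R]_(m, n))
    (X : set 'cV[R]_m) (Y : set 'cV[R]_n) (xs : 'cV[R]_m) (ys : 'cV[R]_n) (v : R) :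
  X xs -> Y ys ->
  (forall x, X x -> expected_payoff A x ys <= v) ->
  (forall y, Y y -> v <= expected_payoff A xs y) ->
  nash_equilibrium A X Y xs ys.
Proof.
move=> Xx Yy le_v ge_v; split=> // [x Xx'|y Yy'].
  exact: le_trans (le_v _ Xx') (ge_v _ Yy).
exact: le_trans (le_v _ Xx) (ge_v _ Yy').
Qed.

Lemma expected_payoff_le (R : realType) (m n : nat) (A : 'M[R]_(m, n))
    (x : 'cV[R]_m) (y : 'cV[R]_n) (v : R) :
  (forall i, (A *m y) i 0 <= v) -> prob_vectors m x -> expected_payoff A x y <= v.
Proof.
move=> le_v [x_ge0 x_sum1]; rewrite /expected_payoff -mulmxA mxE.
rewrite -[v]mul1r -x_sum1 mulr_suml; apply: ler_sum => i _.
by rewrite mxE ler_wpM2l.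
Qed.

(** [b] is a Lagrange multiplier for the power constraint: averaging the affine bound over [y]
    yields [a] minus [b] times the mean power, and [0 <= b] lets [Jave] replace that mean. *)
Lemma expected_payoff_ge (R : realType) (m n : nat) (A : 'M[R]_(m, n))
    (J : 'cV[R]_n) (Jave a b : R) (x : 'cV[R]_m) (y : 'cV[R]_n) :
  0 <= b -> (forall j, a - b * J j 0 <= (x^T *m A) 0 j) ->
  power_limited J Jave y -> a - b * Jave <= expected_payoff A x y.
Proof.
move=> b_ge0 ge_v [[y_ge0 y_sum1]]; rewrite mxE => y_power.
apply: (@le_trans _ _ (\sum_j (a - b * J j 0) * y j 0)); last first.
  by rewrite /expected_payoff mxE; apply: ler_sum => j _; rewrite ler_wpM2r.
under eq_bigr do rewrite mulrBl.
rewrite sumrB -mulr_sumr y_sum1 mulr1 lerD2l lerN2.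
under eq_bigr do rewrite -mulrA.
rewrite -mulr_sumr ler_wpM2l //; apply: le_trans y_power.
by rewrite le_eqVlt; apply/orP; left; apply/eqP/eq_bigr => j _; rewrite mxE mulrC.
Qed.

(** Mass function of the cumulative distribution [F], taken to be 0 before index 0. *)
Definition increment (R : zmodType) (F : nat -> R) (j : nat) : R :=
  F j - (if j is j'.+1 then F j' else 0).

Lemma sum_increment (R : zmodType) (F : nat -> R) (n : nat) :
  \sum_(j < n.+1) increment F j = F n.
Proof.
elim: n => [|n IHn]; first by rewrite big_ord1 /increment subr0.
by rewrite big_ord_recr IHn /increment /= addrC subrK.
Qed.

(** Abel summation, used to read the mean power off the cumulative distribution. *)
Lemma sum_increment_by_parts (R : comRingType) (F G : nat -> R) (n : nat) :
  \sum_(j < n.+1) increment F j * G j =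
  F n * G n - \sum_(j < n) (G j.+1 - G j) * F j.
Proof.
elim: n => [|n IHn]; first by rewrite big_ord1 big_ord0 /increment !subr0.
by rewrite big_ord_recr IHn big_ord_recr /increment /=; ring.
Qed.

Lemma jamming_matrix_mul_increment (R : realType) (n : nat) (z F : nat -> R)
    (i : 'I_n.+1) :
  (jamming_matrix (fun i : 'I_n.+1 => z i) *m \col_j increment F j) i 0 = z i * F i.
Proof.
rewrite mxE -(sum_increment F i) mulr_sumr.
rewrite (big_ord_widen _ (fun j => z i * increment F j) (ltn_ord i)) [RHS]big_mkcond.
by apply: eq_bigr => j _; rewrite !mxE ltnS; case: ifP; rewrite ?mul0r.
Qed.

(** The cut at [k] replaces the minimum of 1 and [v / z i]; the two agree for positive decreasing
    [z] when [z k <= v] and [v <= z i] for all [i < k]. *)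
Definition cumulative (R : realType) (z : nat -> R) (v : R) (k i : nat) : R :=
  if (i < k)%N then v / z i else 1.

Definition step_cost (R : realType) (J z : nat -> R) (k : nat) : R :=
  \sum_(i < k) (J i.+1 - J i) / z i.

Lemma cumulative_prob (R : realType) (N k : nat) (z : nat -> R) (v : R) :
  (k <= N)%N -> (forall i, (i < k)%N -> 0 < z i) ->
  (forall i, (i.+1 < k)%N -> z i.+1 <= z i) ->
  0 <= v -> (forall i, (i < k)%N -> v <= z i) ->
  prob_vectors N.+1 (\col_j increment (cumulative z v k) j).
Proof.
move=> lekN z_gt0 z_decr v_ge0 v_le; split=> [j|].
  rewrite mxE subr_ge0; case: (j : nat) => [|i]; rewrite /cumulative.
    by case: ifP => // k_gt0; rewrite divr_ge0 // ltW // z_gt0.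
  (* Below [k] the distribution grows because [z] decreases; the jump to 1 at [k] is nonnegative
     because [v <= z i]. *)
  case: (ltnP i.+1 k) => [ltik|leki].
    by rewrite (ltnW ltik) ler_wpM2l // lef_pV2 ?posrE ?z_gt0 ?z_decr // ltnW.
  by case: ifP => // ltik; rewrite ler_pdivrMr ?mul1r ?v_le ?z_gt0.
under eq_bigr do rewrite mxE.
by rewrite sum_increment /cumulative ltnNge lekN.
Qed.

Lemma cumulative_power (R : realType) (N k : nat) (J z : nat -> R) (v : R) :
  (k <= N)%N ->
  \sum_(j < N.+1) increment (cumulative z v k) j * J j = J k - v * step_cost J z k.
Proof.
move=> lekN; rewrite sum_increment_by_parts {1}/cumulative ltnNge lekN mul1r.
suff -> : \sum_(j < N) (J j.+1 - J j) * cumulative z v k j =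
          v * step_cost J z k + (J N - J k) by ring.
rewrite -(big_mkord xpredT (fun j => (J j.+1 - J j) * cumulative z v k j)).
(* From [k] on the distribution is 1, so those steps of [J] telescope. *)
rewrite (big_cat_nat (leq0n k) lekN) /=; congr (_ + _).
  rewrite big_mkord mulr_sumr; apply: eq_bigr => i _.
  by rewrite /cumulative ltn_ord mulrCA.
rewrite -telescope_sumr //; apply: eq_big_nat => i /andP[leki _].
by rewrite /cumulative ltnNge leki mulr1.
Qed.

Definition ramp (R : realType) (J z : nat -> R) (k i : nat) : R :=
  if (i < k)%N then (J i.+1 - J i) / z i / step_cost J z k else 0.

Lemma ramp_prob (R : realType) (N k : nat) (J z : nat -> R) :
  (k <= N)%N -> (forall i, (i < k)%N -> 0 < z i) ->
  (forall i, (i < k)%N -> J i <= J i.+1) -> 0 < step_cost J z k ->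
  prob_vectors N.+1 (\col_i ramp J z k i).
Proof.
move=> lekN z_gt0 J_incr D_gt0; split=> [i|].
  rewrite mxE /ramp; case: ifP => // ltik.
  by rewrite !divr_ge0 ?subr_ge0 ?J_incr // ltW // z_gt0.
under eq_bigr do rewrite mxE.
rewrite /ramp -big_mkcond.
rewrite -(big_ord_widen _ (fun i => (J i.+1 - J i) / z i / step_cost J z k)) ?leqW //.
by rewrite -mulr_suml divff // gt_eqF.
Qed.

(** Each weight's factor [1 / z i] cancels the payoff [z i], and the remaining steps of [J] from [j]
    to [k] telescope. *)
Lemma ramp_payoff (R : realType) (N k : nat) (J z : nat -> R) (j : 'I_N.+1) :
  (k <= N)%N -> (forall i, (i < k)%N -> z i != 0) ->
  ((\col_i ramp J z k i)^T *m jamming_matrix (fun i : 'I_N.+1 => z i)) 0 j =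
  if (j <= k)%N then (J k - J j) / step_cost J z k else 0.
Proof.
move=> lekN z_neq0.
transitivity (\sum_(i < N.+1 | (i < k)%N)
    if (j <= i)%N then (J i.+1 - J i) / step_cost J z k else 0).
  rewrite mxE [RHS]big_mkcond; apply: eq_bigr => i _; rewrite !mxE /ramp.
  case: ifP => ltik; last by rewrite mul0r.
  case: ifP => _; last by rewrite mulr0.
  by rewrite mulrAC divfK // z_neq0.
rewrite -(big_ord_widen _ (fun i : nat =>
  if (j <= i)%N then (J i.+1 - J i) / step_cost J z k else 0)) ?leqW // -big_mkcond.
case: leqP => [lejk|ltkj]; last first.
  by rewrite big_pred0 // => i; apply/negbTE; rewrite -ltnNge (ltn_trans _ ltkj).
rewrite -mulr_suml -telescope_sumr // big_geq_mkord.
by congr (_ * _); apply: eq_bigl.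
Qed.

Theorem lemma2 (R : realType) (NT : nat) (hNT : (1 <= NT)%N)
    (J : 'cV[R]_NT.+1)
    (J0 : J ord0 0 = 0)
    (J_incr : forall i j : 'I_NT.+1, (i < j)%N -> J i 0 < J j 0)
    (z : 'I_NT.+1 -> R)
    (z_decr : forall i j : 'I_NT.+1, (i < j)%N -> z j < z i)
    (z_pos : 0 < z ord_max)
    (Jave : R) (Jave_ge0 : 0 <= Jave) (Jave_le : Jave <= J ord_max 0) :
  exists (x y : 'cV[R]_NT.+1),
    nash_equilibrium (jamming_matrix z)
      (prob_vectors NT.+1) (power_limited J Jave) x y.
Proof.
(* Indexing by [nat] allows [i.+1]; past [NT], [inord] gives a default value, hence the bounds by
   [NT] below. *)
pose zn i := z (inord i); pose Jn i := J (inord i) 0.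
have znE (i : 'I_NT.+1) : z i = zn i by rewrite /zn inord_val.
have JnE (i : 'I_NT.+1) : J i 0 = Jn i by rewrite /Jn inord_val.
have AE : jamming_matrix z = jamming_matrix (fun i : 'I_NT.+1 => zn i).
  by apply/matrixP => i j; rewrite !mxE znE.
have zn_lt i j : (i < j <= NT)%N -> zn j < zn i.
  by case/andP=> ltij lejN; apply: z_decr; rewrite !inordK // ltnS (leq_trans (ltnW _) lejN).
have Jn_lt i j : (i < j <= NT)%N -> Jn i < Jn j.
  by case/andP=> ltij lejN; apply: J_incr; rewrite !inordK // ltnS (leq_trans (ltnW _) lejN).
have zn_le i j : (i <= j <= NT)%N -> zn j <= zn i.
  rewrite leq_eqVlt; case: eqP => [-> //|_] /= lt_ij.
  exact: ltW (zn_lt _ _ lt_ij).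
have znN_gt0 : 0 < zn NT by rewrite -(znE ord_max).
have zn_gt0 i : (i <= NT)%N -> 0 < zn i.
  by move=> leiN; apply: lt_le_trans znN_gt0 _; apply: zn_le; rewrite leiN leqnn.
(* Everything but the row strategy follows from [zn k <= v <= zn i] and the budget. *)
have reduce k v x : (k <= NT)%N -> zn k <= v -> (forall i, (i < k)%N -> v <= zn i) ->
    Jn k - v * step_cost Jn zn k <= Jave -> prob_vectors NT.+1 x ->
    (forall y, power_limited J Jave y -> v <= expected_payoff (jamming_matrix z) x y) ->
    exists x y, nash_equilibrium (jamming_matrix z)
      (prob_vectors NT.+1) (power_limited J Jave) x y.
  move=> lekN le_zkv le_vz le_power x_prob x_ge.
  have v_ge0 : 0 <= v by rewrite (le_trans _ le_zkv) // ltW // zn_gt0.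
  exists x, (\col_j increment (cumulative zn v k) j).
  apply: (saddle_value_nash (v := v)) => //.
  - split.
      apply: cumulative_prob => // i ltik.
        by apply: zn_gt0; rewrite ltnW // (leq_trans ltik).
      by apply: zn_le; rewrite leqnSn (leq_trans (ltnW ltik)).
    rewrite mxE; under eq_bigr do rewrite !mxE JnE.
    by rewrite cumulative_power.
  - move=> x' x'_prob; apply: expected_payoff_le x'_prob => i.
    rewrite AE jamming_matrix_mul_increment /cumulative.
    have zi_gt0 : 0 < zn i by apply: zn_gt0; rewrite -ltnS.
    case: ltnP => [_|leki]; first by rewrite mulrC divfK ?gt_eqF.
    by rewrite mulr1 (le_trans _ le_zkv) // zn_le // leki -ltnS /=.
pose e k := Jn k - zn k * step_cost Jn zn k.
case: (lerP (e NT) Jave) => [le_eN|lt_eN].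
  apply: (reduce NT (zn NT) (delta_mx ord_max 0)) => //.
  - by move=> i ltiN; rewrite zn_le // leqnn ltnW.
  - split=> [i|]; first by rewrite mxE ler0n.
    rewrite (bigD1 ord_max) //= mxE !eqxx big1 ?addr0 // => i /negbTE neq.
    by rewrite mxE neq.
  (* The last row pays [zn NT] in every column, so the multiplier is 0. *)
  - move=> y y_lim; rewrite -[zn NT]subr0 -(mul0r Jave).
    apply: expected_payoff_ge y_lim => // j.
    rewrite mul0r subr0 trmx_delta -rowE !mxE.
    by rewrite -ltnS ltn_ord -(znE ord_max).
have ex_e : exists k, (k <= NT)%N && (Jave < e k) by exists NT; rewrite leqnn.
(* The least index is not 0, since [e 0 = 0 <= Jave]; it is written [k.+1] from here on. *)
case: (ex_minnP ex_e) => -[|k] /andP[lekN lt_e] k_min.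
  move: lt_e; rewrite /e /step_cost big_ord0 mulr0 subr0 /Jn.
  have -> : inord 0 = ord0 :> 'I_NT.+1 by apply/val_inj; rewrite /= inordK.
  by rewrite J0 ltNge Jave_ge0.
have le_e : e k <= Jave.
  rewrite leNgt; apply/negP => lt_ek; have := k_min k.
  by rewrite lt_ek (ltnW lekN) ltnn => /(_ isT).
set D := step_cost Jn zn k.+1 in lt_e.
have z_gt0 i : (i < k.+1)%N -> 0 < zn i.
  by move=> ltik; apply: zn_gt0; rewrite ltnW // (leq_trans ltik).
have J_lt i : (i < k.+1)%N -> Jn i < Jn i.+1.
  by move=> ltik; apply: Jn_lt; rewrite leqnn (leq_trans ltik).
have D_gt0 : 0 < D.
  rewrite /D /step_cost big_ord_recr /= ltr_wpDl //; last first.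
    by rewrite divr_gt0 ?subr_gt0 ?J_lt ?z_gt0.
  apply: sumr_ge0 => i _; have ltik : (i < k.+1)%N by rewrite ltnW // ltnS.
  by rewrite divr_ge0 // ?subr_ge0 ltW // ?J_lt ?z_gt0.
(* [D] also gives the cost at level [zn k], since its last term is [(Jn k.+1 - Jn k) / zn k]. *)
have eE : e k = Jn k.+1 - zn k * D.
  have zk_neq0 : zn k != 0 by rewrite gt_eqF // z_gt0.
  by rewrite /D /step_cost big_ord_recr /= /e /step_cost; field.
apply: (reduce k.+1 ((Jn k.+1 - Jave) / D) (\col_i ramp Jn zn k.+1 i)) => //.
(* The inequalities [Jave < e k.+1] and [e k <= Jave], both written with the same [D], place the
   value between [zn k.+1] and [zn k]. *)
- by rewrite ler_pdivlMr //; move: lt_e; rewrite /e -/D; lra.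
- move=> i ltik; apply: (@le_trans _ _ (zn k)).
    by rewrite ler_pdivrMr //; rewrite eE in le_e; lra.
  by rewrite zn_le // -ltnS ltik ltnW.
- by rewrite -/D divfK ?gt_eqF // subKr.
- by apply: ramp_prob => // i ltik; rewrite ltW // J_lt.
(* The multiplier is [D^-1], with constant term [Jn k.+1 / D]. *)
- move=> y y_lim; rewrite mulrBl [Jave / D]mulrC.
  apply: expected_payoff_ge y_lim => [|j]; first by rewrite invr_ge0 ltW.
  rewrite AE ramp_payoff // => [|i /z_gt0 zi_gt0]; last by rewrite gt_eqF.
  rewrite JnE [_^-1 * _]mulrC -mulrBl; case: ifPn => // /negbTE gt_jk.
  (* Past [k.+1] the payoff is 0 and the affine bound is negative. *)
  rewrite pmulr_lle0 ?invr_gt0 // subr_le0 ltW // Jn_lt //.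
  by rewrite ltnNge gt_jk -ltnS ltn_ord.
Qed.
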